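(* For every finite $d$-dimensional poset $P$ on $k$ elements there is a $d$-dimensional permutation hypermatrix $M_P$ of size $k\times\cdots\times k$ with the following property: if $K$ is a constant such that, for every positive integer $n$, every $M_P$-free $d$-dimensional $0$-$1$ hypermatrix of size $n\times\cdots\times n$ has at most $Kn^{d-1}$ non-zero entries, then for every positive integer $n$ $$La^{\#}(n,P)\le 2^d K\binom{n}{\lfloor n/2\rfloor}.$$
   Context: Let $[n]=\{1,\ldots,n\}$. Posets. The dimension of a poset $P$ is the least integer $t\ge 1$ for which there exist $t$ linear orderings $<_1,\ldots,<_t$ of the elements of $P$ such that for all (distinct) $x,y\in P$, $x<_P y$ if and only if $x<_i y$ for all $1\le i\le t$; $P$ is $d$-dimensional if its dimension is $d$. A family $\mathcal{F}$ of subsets of $[n]$ contains $P$ as an induced subposet if there is an injection $\alpha:P\to\mathcal{F}$ such that for all $x_1,x_2\in P$, $x_1<_P x_2$ if and only if $\alpha(x_1)\subset\alpha(x_2)$ (strict inclusion); otherwise $\mathcal{F}$ is induced $P$-free. $La^{\#}(n,P)$ is the maximum of $|\mathcal{F}|$ over all induced $P$-free families $\mathcal{F}$ of subsets of $[n]$. Hypermatrices. A $d$-dimensional $0$-$1$ hypermatrix of size $n_1\times\cdots\times n_d$ is an array with entries $M(i_1,\ldots,i_d)\in\{0,1\}$ for $1\le i_j\le n_j$. A submatrix of $M$ is obtained by choosing a subset of the indices in each coordinate and restricting $M$ to these indices, keeping their order. $M$ contains a $d$-dimensional $0$-$1$ hypermatrix $A$ if $M$ has a submatrix $M'$ of the same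 size as $A$ such that $M'(\underline{i})=1$ whenever $A(\underline{i})=1$; otherwise $M$ is $A$-free. A $d$-dimensional permutation hypermatrix of size $k\times\cdots\times k$ is a $0$-$1$ hypermatrix with exactly $k$ entries equal to $1$ that contains exactly one $1$ in each axis-parallel hyperplane (i.e. for every coordinate $j$ and every value $1\le v\le k$ there is exactly one $\underline{i}$ with $i_j=v$ and $M(\underline{i})=1$). *)

(* Defs.v *)
From mathcomp Require Import all_boot all_order.

Set Implicit Arguments.
Unset Strict Implicit.
Unset Printing Implicit Defensive.

(* The ground sets {1, ..., n} of families and of hypermatrix coordinates are *)
(* shifted to 'I_n = {0, ..., n - 1}.                                         *)

Definition strict_linear_order (T : eqType) (r : rel T) : Prop :=
  [/\ irreflexive r, transitive r & forall x y, x != y -> r x y || r y x].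

Definition has_realizer (disp : Order.disp_t) (P : finPOrderType disp)
    (t : nat) : Prop :=
  exists2 L : 'I_t -> rel P,
    forall i, strict_linear_order (L i) &
    forall x y : P, x != y -> ((x < y)%O <-> forall i, L i x y).

Definition has_dimension (disp : Order.disp_t) (P : finPOrderType disp)
    (d : nat) : Prop :=
  [/\ 0 < d, has_realizer P d
    & forall t, 0 < t -> has_realizer P t -> d <= t].

Definition contains_induced (disp : Order.disp_t) (P : finPOrderType disp)
    (n : nat) (F : {set {set 'I_n}}) : bool :=
  [exists alpha : {ffun P -> {set 'I_n}},
    [&& injectiveb alpha, [forall x, alpha x \in F]
      & [forall x, forall y, (x < y)%O == (alpha x \proper alpha y)]]].

(* A genuine maximum as soon as P is nonempty, because the empty family is    *)
(* then induced P-free; for empty P no family is, and the value is junk (0).  *)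
Definition La_sharp (n : nat) (disp : Order.disp_t) (P : finPOrderType disp) :
    nat :=
  \max_(F : {set {set 'I_n}} | ~~ contains_induced P F) #|F|.

(* d-dimensional 0-1 hypermatrices of size n x ... x n; true stands for 1.    *)
Definition hypermatrix (d n : nat) : Type := {ffun 'I_d -> 'I_n} -> bool.

Definition weight (d n : nat) (M : hypermatrix d n) : nat := #|[set i | M i]|.

(* S j is the set of indices kept in coordinate j.  As 'I_n is enumerated in  *)
(* increasing order, enum_val sends a to the a-th smallest element of S j.    *)
Definition submatrix (d n k : nat) (M : hypermatrix d n)
    (S : 'I_d -> {set 'I_n}) (cardS : forall j, #|S j| = k) :
    hypermatrix d k :=
  fun i => M [ffun j => enum_val (cast_ord (esym (cardS j)) (i j))].

Definition contains (d n k : nat) (M : hypermatrix d n) (A : hypermatrix d k) :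
    Prop :=
  exists (S : 'I_d -> {set 'I_n}) (cardS : forall j, #|S j| = k),
    forall i, A i -> submatrix M cardS i.

Definition permutation_hypermatrix (d k : nat) (M : hypermatrix d k) : Prop :=
  weight M = k /\
  forall (j : 'I_d) (v : 'I_k), #|[set i | M i & i j == v]| = 1.

(* Main.v *)
Require Import Defs.
From mathcomp Require Import all_boot all_order all_algebra.
From mathcomp Require Import fingroup perm zify ring.

Set Implicit Arguments.
Unset Strict Implicit.
Unset Printing Implicit Defensive.

Import Order.TTheory GRing.Theory Num.Theory.

(** The matrix of [P] is read off a realizer: its ones sit at the points whose
    coordinates are the heights of the elements of [P] in the [d] linear orders.
    The order of [P] then is the strict product order of these points.

    Cut ['I_n] into [d] blocks of sizes [m j].  Taking, in block [j], the first
    [t j] elements embeds the box of all [t] with [t j <= m j] into the subsets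
    of ['I_n], with inclusion corresponding to the product order.  A copy of the
    matrix of [P] among the points of the box that are sent into a family [F]
    would be an induced copy of [P] in [F].  Hence, for every permutation [s] of
    ['I_n], an induced [P]-free [F] meets the box moved by [s] in at most
    [K * N ^ (d - 1)] points, where [N] exceeds all the [m j]
    ([pullback_free]).

    On average over [s], a set of size [a] is met [level a / 'C(n, a)] times,
    where [level a] counts the points of coordinate sum [a] in the box.  The
    heart of the proof is that this ratio is smallest at [a = n./2]
    ([tame_center]).  The [level a] are the coefficients of the product [w] of
    the polynomials [1 + X + ... + X ^ (m j)], and the claim amounts to a sign
    condition on the coefficients of [n w - (1 + X) w'].  This expression obeys
    a Leibniz rule, and the sign condition survives multiplication by a
    palindromic unimodal polynomial ([skewM]), so everything reduces to a single
    factor ([tame_range]).  As [level] is itself largest at [n./2], its value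
    there is at least the average [\prod_j (m j).+1 / n.+1] ([level_center]).

    Altogether [#|F| * \prod_j (m j).+1] is at most
    [n.+1 * 'C(n, n./2) * K * N ^ (d - 1)], and for blocks of nearly equal sizes
    an elementary estimate ([balanced_bound]) bounds [n.+1 * N ^ (d - 1)] by
    [2 ^ d * \prod_j (m j).+1]. *)

(** * Palindromic unimodal polynomials *)

Section Bell.
Local Open Scope ring_scope.

(** Indexing coefficients by [int], with zeros on the negative side, frees the
    reflections [x |-> n - x] and the convolutions from range conditions. *)
Definition bicoef (p : {poly int}) (x : int) : int :=
  if x is Posz a then p`_a else 0.

(** Palindromic and unimodal, with centre of symmetry [n / 2]. *)
Definition bell (n : nat) (p : {poly int}) : Prop :=
  (forall x : int, bicoef p (n%:Z - x) = bicoef p x) /\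
  (forall x : int, x * 2 <= n.+1%:Z -> bicoef p (x - 1) <= bicoef p x).

(** Antisymmetric about [c / 2], with nonnegative first half: the shape of the
    successive differences of a palindromic unimodal sequence. *)
Definition skew (c : nat) (p : {poly int}) : Prop :=
  (forall x : int, bicoef p (c%:Z - x) = - bicoef p x) /\
  (forall x : int, x * 2 <= c%:Z -> 0 <= bicoef p x).

Lemma bicoefD p q x : bicoef (p + q) x = bicoef p x + bicoef q x.
Proof. by case: x => a //=; rewrite coefD. Qed.

Lemma bicoefMX p x : bicoef ('X * p) x = bicoef p (x - 1).
Proof.
case: x => [[|a]|a]; [by rewrite /= coefXM| |by []].
have -> : a.+1%:Z - 1 = a%:Z by lia.
by rewrite /= coefXM.
Qed.

Lemma bicoefM (p q : {poly int}) (b : nat) (x : int) : (size p <= b)%N ->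
  bicoef (p * q) x = \sum_(i < b) p`_i * bicoef q (x - i%:Z).
Proof.
move=> sp; case: x => [a|a] /=; last first.
  by rewrite big1 // => i _; case E: (_ - _) => [m|m]; rewrite ?mulr0 //; lia.
have E (i : nat) : (a < i)%N -> p`_i * bicoef q (a%:Z - i%:Z) = 0.
  by move=> ai; case E: (_ - _) => [m|m]; rewrite ?mulr0 //; lia.
have E' (i : nat) : (b <= i)%N -> p`_i = 0.
  by move=> bi; rewrite nth_default // (leq_trans sp).
set G := fun i : nat => p`_i * bicoef q (a%:Z - i%:Z).
transitivity (\sum_(i < a.+1) G i).
  rewrite coefM; apply: eq_bigr => i _; rewrite /G subzn //.
  by rewrite -ltnS.
rewrite -(big_mkord xpredT G) -(big_mkord xpredT G).
case: (leqP a.+1 b) => h.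
  rewrite [RHS](@big_cat_nat _ _ _ a.+1) //= (_ : \sum_(a.+1 <= i < b) G i = 0).
    by rewrite addr0.
  by rewrite big_nat_cond big1 // => i /andP[/andP[ai _] _]; apply: E.
rewrite (@big_cat_nat _ _ _ b) //= ?(ltnW h) //.
rewrite (_ : \sum_(b <= i < a.+1) G i = 0) ?addr0 //.
rewrite big_nat_cond big1 // => i /andP[/andP[bi _] _].
by rewrite /G E' ?mul0r.
Qed.

(** The usable form of [bell]: coefficients decrease with the distance to the
    centre, on both sides together. *)
Lemma bell_le n p x y : bell n p ->
  `|x * 2 - n%:Z| <= `|y * 2 - n%:Z| -> bicoef p y <= bicoef p x.
Proof.
case=> sym mono.
have up (k : nat) z : z * 2 <= n.+1%:Z -> bicoef p (z - k%:Z) <= bicoef p z.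
  elim: k z => [|k IH] z hz; first by rewrite subr0.
  apply: (le_trans _ (mono z hz)).
  have -> : z - k.+1%:Z = z - 1 - k%:Z by lia.
  by apply: IH; lia.
have up2 a b : a <= b -> b * 2 <= n.+1%:Z -> bicoef p a <= bicoef p b.
  move=> ab hb; have -> : a = b - `|b - a|%N%:Z by lia.
  exact: up.
move=> H.
have [hx|hx] := lerP (x * 2) n%:Z; have [hy|hy] := lerP (y * 2) n%:Z.
- by apply: up2; lia.
- by rewrite -(sym y); apply: up2; lia.
- by rewrite -(sym x); apply: up2; lia.
- by rewrite -(sym x) -(sym y); apply: up2; lia.
Qed.

Lemma bell_size n p : bell n p -> (size p <= n.+1)%N.
Proof.
case=> sp _; apply/leq_sizeP => j hj; have /= <- := sp j%:Z.
by case E: (_ - _) => [m|m] //; lia.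
Qed.

Lemma skew_size c p : skew c p -> (size p <= c.+1)%N.
Proof.
case=> sk _; apply/leq_sizeP => j hj.
have /= := sk j%:Z; case E: (_ - _) => [m|m]; first lia.
by move=> /eqP; rewrite eq_sym oppr_eq0 => /eqP.
Qed.

Lemma skew_coef c p (i : nat) : skew c p -> (i <= c)%N -> p`_(c - i) = - p`_i.
Proof. by case=> sk _ ic; have := sk i%:Z; rewrite subzn. Qed.

(** Averaging the convolution with its own reflection groups the terms as
    [p_i * (q_(x - i) - q_(x - c + i))].  For [x] left of the centre, both
    factors change sign at [i = c / 2], so every term is nonnegative. *)
Lemma skewM c n p q : skew c p -> bell n q -> skew (c + n) (p * q).
Proof.
move=> sp bq; have szp := skew_size sp; have [sq _] := bq.
have rev x : bicoef (p * q) x =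
    - \sum_(i < c.+1) p`_i * bicoef q (x - c%:Z + i%:Z).
  rewrite (bicoefM _ _ szp) (reindex_inj rev_ord_inj) /= -sumrN.
  apply: eq_bigr => i _; rewrite subSS (skew_coef sp) -1?ltnS // mulNr.
  by congr (- (_ * bicoef q _)); have := ltn_ord i; lia.
split=> x.
  rewrite rev (bicoefM _ _ szp); congr (- _); apply: eq_bigr => i _.
  by rewrite -(sq (x - i%:Z)); congr (_ * bicoef q _); lia.
move=> hx.
(* Twice the coefficient: once as it is, once reflected. *)
suff : 0 <= bicoef (p * q) x + bicoef (p * q) x by lia.
rewrite {2}rev (bicoefM _ _ szp) -sumrB; apply: sumr_ge0 => i _.
rewrite -mulrBr; have ic : (i <= c)%N by rewrite -ltnS.
have [h|h] := leqP (i * 2) c.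
  apply: mulr_ge0; first by apply: (proj2 sp i%:Z); lia.
  by rewrite subr_ge0; apply: (bell_le bq); lia.
rewrite -mulrNN; apply: mulr_ge0.
  rewrite -(skew_coef sp ic); apply: (proj2 sp (c - i)%N%:Z); lia.
by rewrite oppr_ge0 subr_le0; apply: (bell_le bq); lia.
Qed.

Lemma bell_skew n p :
  bell n p -> skew n.+1 ((1 - 'X) * p).
Proof.
have E x : bicoef ((1 - 'X) * p) x = bicoef p x - bicoef p (x - 1).
  have -> : (1 - 'X) * p = p + (- 'X) * p by ring.
  rewrite bicoefD; congr (_ + _).
  rewrite mulNr -bicoefMX; case: x => a //=; first by rewrite coefN.
move=> [sym mono]; split=> x; rewrite !E.
  have -> : n.+1%:Z - x = n%:Z - (x - 1) by lia.
  have -> : n%:Z - (x - 1) - 1 = n%:Z - x by lia.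
  by rewrite !sym opprB.
by move=> hx; rewrite subr_ge0; apply: mono.
Qed.

(** Unimodality of [p * q] is the sign of the first half of
    [(1 - X) * p * q], hence an instance of [skewM]. *)
Lemma bellM n1 n2 p q : bell n1 p -> bell n2 q -> bell (n1 + n2) (p * q).
Proof.
move=> bp bq; split=> x.
  have [sp _] := bp; have [sq _] := bq.
  have szp := bell_size bp.
  rewrite !(bicoefM _ _ szp) (reindex_inj rev_ord_inj) /=.
  apply: eq_bigr => i _; rewrite subSS; have := ltn_ord i; rewrite ltnS => hi.
  have := sp i%:Z; rewrite subzn // => /= ->.
  by rewrite -(sq (x - i%:Z)); congr (_ * bicoef q _); lia.
move=> hx; rewrite -subr_ge0.
have [_ /(_ x)] := skewM (bell_skew bp) bq.
have -> : (1 - 'X) * p * q = p * q + - ('X * (p * q)) by ring.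
rewrite bicoefD.
have -> : bicoef (- ('X * (p * q))) x = - bicoef ('X * (p * q)) x.
  by case: (x) => a //=; rewrite coefN.
by rewrite bicoefMX; apply; lia.
Qed.

(** * Comparison with the binomial coefficients *)

(** Vanishes for [p = (1 + X) ^ n].  In general its coefficients tell whether
    those of [p] grow more slowly than the binomial coefficients
    ([coef_defect]), and it obeys a Leibniz rule ([defectM]).  The factor ['X]
    shifts the index of antisymmetry from [n - 1] to [n + 1], which makes it
    a natural number also for [n = 0] and equal to the one in [bell_skew]. *)
Definition defect (n : nat) (p : {poly int}) : {poly int} :=
  'X * (p *+ n - (1 + 'X) * p^`()).

Lemma defectM n1 n2 p q :
  defect (n1 + n2) (p * q) = defect n1 p * q + defect n2 q * p.
Proof. by rewrite /defect derivM mulrnDr; ring. Qed.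

Lemma skewD c p q : skew c p -> skew c q -> skew c (p + q).
Proof.
move=> [sp pp] [sq pq]; split=> x; rewrite !bicoefD ?sp ?sq ?opprD //.
by move=> hx; rewrite addr_ge0 ?pp ?pq.
Qed.

(** The multiplicative invariant: by [defectM], the defect of one factor gets
    multiplied by the other factor, which has to be [bell] for [skewM]. *)
Definition tame (n : nat) (p : {poly int}) : Prop :=
  bell n p /\ skew n.+1 (defect n p).

Lemma tameM n1 n2 p q : tame n1 p -> tame n2 q -> tame (n1 + n2) (p * q).
Proof.
move=> [bp sp] [bq sq]; split; first exact: bellM.
rewrite defectM; apply: skewD; first exact: (skewM sp bq).
by rewrite addnC; apply: (skewM sq bp).
Qed.

Lemma coef_defect n p (a : nat) :
  (defect n p)`_a.+1 = (n%:Z - a%:Z) * p`_a - a.+1%:Z * p`_a.+1.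
Proof.
rewrite /defect coefXM /= coefB coefMn mulrDl mul1r coefD coefXM !coef_deriv.
have nZ k (z : int) : z *+ k = k%:Z * z by rewrite -mulr_natl natz.
rewrite !nZ; case: a => [|a] /=.
  by rewrite addr0 subr0.
by rewrite mulrBl opprD addrA addrAC.
Qed.

Definition rangepoly (m : nat) : {poly int} := \sum_(i < m.+1) 'X^i.

Lemma coef_rangepoly m a : (rangepoly m)`_a = (a <= m)%N%:R.
Proof.
rewrite /rangepoly coef_sum.
under eq_bigr do rewrite coefXn.
case: leqP => h.
  rewrite (bigD1 (Ordinal (h : a < m.+1)%N)) //= eqxx big1 ?addr0 // => i.
  by rewrite -val_eqE /= eq_sym => /negPf->.
by rewrite big1 // => i _; case: eqP => // E; have := ltn_ord i; lia.
Qed.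

(** The coefficients of the defect are the [m + 1 - 2 a] for [0 < a <= m]. *)
Lemma tame_range m : tame m (rangepoly m).
Proof.
have B (x : int) : bicoef (rangepoly m) x = ((0 <= x) && (x <= m%:Z))%:R.
  by case: x => a //=; rewrite coef_rangepoly.
split.
  split=> x; first by rewrite !B; congr ((_ : bool)%:R); lia.
  by move=> hx; rewrite !B; case: andP; case: andP => //; lia.
have C (x : int) : bicoef (defect m (rangepoly m)) x =
    if (0 < x) && (x <= m%:Z) then m.+1%:Z - x * 2 else 0.
  case: x => [[|a]|a] //=; first by rewrite /defect coefXM.
  rewrite coef_defect !coef_rangepoly.
  case: (ltngtP a m) => h //=.
  - by rewrite ifT; lia.
  - by rewrite ifF; lia.
  - by rewrite ifF; lia.
split=> x; rewrite !C.
  by case: ifP; case: ifP; lia.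
by move=> hx; case: ifP; lia.
Qed.

Lemma tame_prod (I : finType) (m : I -> nat) :
  tame (\sum_j m j) (\prod_j rangepoly (m j)).
Proof.
apply: (big_ind2 (fun n p => tame n p)).
- have -> : 1 = rangepoly 0 by rewrite /rangepoly big_ord1 expr0.
  exact: tame_range.
- by move=> *; apply: tameM.
- by move=> j _; apply: tame_range.
Qed.

(** The sign of the defect at [a + 1], rewritten with
    [a.+1 * 'C(n, a.+1) = (n - a) * 'C(n, a)]. *)
Lemma tame_step n p (a : nat) : tame n p -> (a.*2 < n)%N ->
  p`_a.+1 * 'C(n, a)%:Z <= p`_a * 'C(n, a.+1)%:Z.
Proof.
move=> [_ [_ /(_ a.+1%:Z)]] /=; rewrite coef_defect => H ha.
have {}H : a.+1%:Z * p`_a.+1 <= (n - a)%N%:Z * p`_a.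
  by rewrite -subr_ge0 -subzn; [apply: H; lia | lia].
rewrite -(ler_pM2l (_ : 0 < a.+1%:Z)) //.
have -> : a.+1%:Z * (p`_a * 'C(n, a.+1)%:Z) = p`_a * (a.+1 * 'C(n, a.+1))%N%:Z.
  by rewrite PoszM; ring.
rewrite mul_bin_left PoszM [leLHS]mulrA [leRHS]mulrCA [leRHS]mulrA.
exact: ler_wpM2r.
Qed.

(** Below the middle, [tame_step] makes [p`_a / 'C(n, a)] decrease towards
    [n./2]; above the middle, both sequences are palindromic. *)
Lemma tame_center n p (a : nat) : tame n p -> (a <= n)%N ->
  p`_(n./2) * 'C(n, a)%:Z <= p`_a * 'C(n, n./2)%:Z.
Proof.
move=> tp; wlog : a / (a.*2 <= n)%N => [W an|a2n _].
  have [|h] := leqP a.*2 n; first by move=> h; apply: W.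
  have := W (n - a)%N; rewrite bin_sub //.
  have := proj1 (proj1 tp) a%:Z; rewrite subzn // => /= ->.
  by apply; lia.
have {a2n} : (a <= n./2)%N by rewrite geq_half_double.
move: {2}(_ - a)%N (erefl (n./2 - a)%N) => k.
elim: k a => [|k IH] a; first by move=> h1 h2; have -> : a = n./2 by lia.
move=> hk ha.
have ha' : (a.*2 < n)%N by lia.
have b0 : 0 < 'C(n, a.+1)%:Z by rewrite ltz_nat bin_gt0; lia.
have IH' := IH a.+1 ltac:(lia) ltac:(lia).
rewrite -(ler_pM2r b0) mulrAC (le_trans (ler_wpM2r _ IH')) //.
by rewrite mulrAC [leRHS]mulrAC ler_wpM2r // tame_step.
Qed.

Lemma tame_eval1 n p : tame n p -> p.[1] <= n.+1%:Z * p`_(n./2).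
Proof.
move=> tp; have bp := proj1 tp.
rewrite (horner_coef_wide _ (bell_size bp)).
rewrite (le_trans (_ : _ <= \sum_(i < n.+1) p`_(n./2))) //.
  apply: ler_sum => i _; rewrite expr1n mulr1.
  by apply: (@bell_le n p (n./2)%:Z i%:Z bp); lia.
by rewrite sumr_const card_ord -mulr_natl natz.
Qed.

Lemma rangepoly_eval1 m : (rangepoly m).[1] = m.+1%:Z.
Proof.
rewrite /rangepoly horner_sum; under eq_bigr do rewrite hornerXn expr1n.
by rewrite sumr_const card_ord natz.
Qed.

End Bell.

(** * Levels of a box *)

Section Levels.
Variables (d N : nat) (m : 'I_d -> nat).
Hypothesis mN : forall j, m j < N.

Definition inbox (t : {ffun 'I_d -> 'I_N}) : bool := [forall j, t j <= m j].

Definition level (a : nat) : nat :=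
  #|[set t : {ffun 'I_d -> 'I_N} | inbox t & \sum_j t j == a]|.

Lemma coef_prod_range a :
  ((\prod_j rangepoly (m j))`_a)%R = (level a)%:R%R.
Proof.
have E j : rangepoly (m j) = (\sum_(i : 'I_N | (i <= m j)%N) 'X^i)%R.
  rewrite /rangepoly (big_ord_widen N (fun i => 'X^i)%R) //.
rewrite (eq_bigr _ (fun j _ => E j)) bigA_distr_big_dep coef_sum.
rewrite /level -sum1_card natr_sum big_mkcond [RHS]big_mkcond /=.
apply: eq_bigr => t _; rewrite [in RHS]inE.
rewrite [t \in _](_ : _ = inbox t) //.
case: ifP => // _ /=.
rewrite prodrXr coefXn eq_sym.
by case: eqP.
Qed.

(** In terms of averages: a random image of the box contains a given set of size
    [a] at least as often as it would if the points of the box were spread evenly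
    over the [n.+1] levels and [a] were the middle level.  The ratio
    [level a / 'C(n, a)] is least in the middle, where [level] is greatest. *)
Lemma level_center (n := \sum_j m j) a : a <= n ->
  (\prod_j (m j).+1) * 'C(n, a) <= n.+1 * 'C(n, n./2) * level a.
Proof.
move=> an; have tp := tame_prod m; rewrite -/n in tp.
have h1 := tame_eval1 tp; have h2 := tame_center tp an.
rewrite !coef_prod_range !natz in h1 h2.
have E : ((\prod_j rangepoly (m j)).[1] = (\prod_j (m j).+1)%N%:Z)%R.
  rewrite horner_prod -natz natr_prod; apply: eq_bigr => j _.
  by rewrite rangepoly_eval1 natz.
rewrite E in h1.
apply: (@leq_trans (n.+1 * (level n./2 * 'C(n, a)))).
  by rewrite mulnA leq_mul2r; apply/orP; right; move: h1; rewrite -PoszM lez_nat.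
rewrite -mulnA leq_mul2l /= [_ * level a]mulnC.
by move: h2; rewrite -!PoszM lez_nat.
Qed.

End Levels.

(** * Averaging over permutations *)

Section Permutations.
Variable T : finType.
Implicit Types (A B : {set T}) (s : {perm T}).

(** List each set followed by its complement and match the two lists. *)
Lemma perm_imset_ex A B : #|A| = #|B| -> exists s : {perm T}, s @: B = A.
Proof.
move=> cAB; pose e (X : {set T}) := enum X ++ enum (~: X) : seq T.
have ue (X : {set T}) : uniq (e X).
  rewrite cat_uniq !enum_uniq andbT /=; apply/hasPn => x.
  by rewrite !mem_enum inE.
have me (X : {set T}) x : x \in e X by rewrite mem_cat !mem_enum inE orbN.
have se (X : {set T}) : size (e X) = #|T|.
  by rewrite size_cat -!cardE cardsC.
pose f x := nth x (e A) (index x (e B)).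
have lt x : index x (e B) < size (e A) by rewrite se -(se B) index_mem.
have injf : injective f.
  move=> x y; rewrite /f (set_nth_default y x) // => /eqP.
  rewrite nth_uniq // => /eqP E.
  by rewrite -(nth_index x (me B x)) E nth_index.
exists (perm injf); apply/eqP; rewrite eqEcard card_imset ?cAB ?leqnn ?andbT.
  apply/subsetP => _ /imsetP[x xB ->]; rewrite permE /f /e.
  have xs : index x (enum B) < size (enum A).
    by rewrite -cardE cAB cardE index_mem mem_enum.
  rewrite nth_cat index_cat mem_enum xB xs.
  by rewrite -mem_enum mem_nth.
exact: perm_inj.
Qed.

(** By transitivity on the sets of a given size, all fibres of [s |-> s @: B]
    have the same size. *)
Lemma card_perm_imset A B : #|A| = #|B| ->
  #|[set s : {perm T} | s @: B == A]| * 'C(#|T|, #|B|) = #|T|`!.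
Proof.
move=> cAB; pose c (X : {set T}) := #|[set s : {perm T} | s @: B == X]|.
have cE (X : {set T}) : #|X| = #|B| -> c X = c A.
  move=> cX; have [s0 s0A] := perm_imset_ex (etrans cAB (esym cX)).
  rewrite /c -(card_imset _ (mulIg s0)); apply: eq_card => s.
  rewrite [RHS]inE; apply/imsetP/eqP => [[u]|sA].
    rewrite inE => /eqP uX ->; rewrite -s0A -uX -imset_comp.
    by apply: eq_imset => x /=; rewrite permM.
  exists (s * s0^-1)%g; last by rewrite mulgKV.
  rewrite inE -(inj_eq (imset_inj (@perm_inj _ s0))) s0A -sA -imset_comp.
  by apply/eqP/eq_imset => x /=; rewrite permM permKV.
have <- : #|[set: {perm T}]| = #|T|`!.
  have -> : #|T|`! = #|perm_on [set: T]| by rewrite card_perm cardsT.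
  by apply: eq_card => s; rewrite inE; apply/esym/subsetP.
rewrite -(card_draws T #|B|) mulnC -sum_nat_const.
rewrite -[RHS]sum1_card [RHS](partition_big (fun s : {perm T} => s @: B)
   (fun X => X \in [set X : {set T} | #|X| == #|B|])) /=; last first.
  by move=> s _; rewrite inE card_imset //; apply: perm_inj.
apply: eq_bigr => X; rewrite inE => /eqP cX.
rewrite -/(c A) -(cE X cX) /c -sum1_card; apply: eq_bigl => s.
by rewrite !inE.
Qed.

End Permutations.

Section Grid.
Variables (d N : nat) (m : 'I_d -> nat).
Hypothesis mN : forall j, m j < N.
Let n := \sum_j m j.
Local Notation box := {ffun 'I_d -> 'I_N}.

(** The blocks are the fibres of [{j : 'I_d & 'I_(m j)}], carried to ['I_n] by
    an arbitrary bijection; [B t] collects the first [t j] elements of each. *)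
Lemma box_embedding : exists B : box -> {set 'I_n},
  (forall t, inbox m t -> #|B t| = \sum_j t j) /\
  (forall t u, inbox m t -> inbox m u ->
     (B t \subset B u) = [forall j, t j <= u j]).
Proof.
pose cell := {j : 'I_d & 'I_(m j)}.
have cc : #|{: cell}| = n.
  rewrite card_tagged sumnE big_map big_enum /=.
  by apply: eq_bigr => j _; rewrite card_ord.
pose h (x : cell) := cast_ord cc (enum_rank x).
have injh : injective h by move=> x y /cast_ord_inj /enum_rank_inj.
exists (fun t : box => h @: [set x : cell | tagged x < t (tag x)]); split.
  move=> t /forallP tm; rewrite card_imset // -sum1_card.
  transitivity (\sum_j \sum_(r < m j | r < t j) 1).
    rewrite sig_big_dep /=; apply: eq_bigl => x; by rewrite inE.
  apply: eq_bigr => j _.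
  by rewrite -(big_ord_widen _ (fun=> 1)) // sum_nat_const card_ord muln1.
move=> t u /forallP tm /forallP um.
apply/subsetP/forallP => [sub j|le x].
  rewrite leqNgt; apply/negP => lt.
  pose x : cell := Tagged (fun j => 'I_(m j)) (Ordinal (leq_trans lt (tm j))).
  have /sub : h x \in h @: [set x : cell | tagged x < t (tag x)].
    by rewrite imset_f // inE.
  by rewrite mem_imset // inE /= ltnn.
case/imsetP => y; rewrite inE => yt ->; rewrite imset_f // inE.
exact: leq_trans yt (le _).
Qed.

(** The trace of [F] on the box moved by [s].  Only the
    points with [t j <= m j] have a meaning as unions of initial segments of
    blocks of sizes [m j]; the others get the entry 0. *)
Definition pullback (B : box -> {set 'I_n}) (F : {set {set 'I_n}})
    (s : {perm 'I_n}) : hypermatrix d N :=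
  fun t => inbox m t && (s @: B t \in F).

(** Double counting of the pairs of a permutation and a point of the box that
    are sent into [F], with [level_center] bounding the contribution of each
    member of [F] from below. *)
Lemma sum_weight_pullback (B : box -> {set 'I_n}) (F : {set {set 'I_n}}) :
  (forall t, inbox m t -> #|B t| = \sum_j t j) ->
  n`! * (\prod_j (m j).+1 * #|F|) <=
  n.+1 * 'C(n, n./2) * \sum_s weight (pullback B F s).
Proof.
move=> cB.
have -> : \sum_s weight (pullback B F s) =
    \sum_(A in F) \sum_(t | inbox m t) #|[set s : {perm 'I_n} | s @: B t == A]|.
  under eq_bigr do rewrite /weight -sum1_card.
  rewrite (exchange_big_dep (inbox m)) /=; last first.
    by move=> s t _; rewrite inE => /andP[].
  rewrite [RHS]exchange_big /=; apply: eq_bigr => t it.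
  rewrite (partition_big (fun s : {perm 'I_n} => s @: B t) (mem F)) /=;
    last by move=> s; rewrite inE => /andP[].
  apply: eq_bigr => A AF; rewrite -sum1_card; apply: eq_bigl => s.
  by rewrite !inE /pullback it /=; case: eqP => [->|]; rewrite ?AF ?andbF.
rewrite mulnA [_ * #|F|]mulnC -sum_nat_const big_distrr /=.
apply: leq_sum => A AF.
have An : #|A| <= n by rewrite -[n in _ <= n]card_ord max_card.
(* [c] is the size of each nonempty fibre, |A|! (n - |A|)! in closed form. *)
pose c := n`! %/ 'C(n, #|A|).
have cE : c * 'C(n, #|A|) = n`!.
  have := @card_perm_imset 'I_n A A erefl; rewrite card_ord /c => <-.
  by rewrite mulnK // bin_gt0.
apply: (@leq_trans (n.+1 * 'C(n, n./2) * (level N m #|A| * c))); last first.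
  rewrite leq_mul2l; apply/orP; right.
  rewrite [X in _ <= X](bigID (fun t : box => \sum_j t j == #|A|)) /=.
  apply: leq_trans (leq_addr _ _).
  rewrite /level -sum_nat_const big_mkcond [X in _ <= X]big_mkcond /=.
  apply: leq_sum => t _; rewrite inE; case: ifP => // /andP[it /eqP tA].
  rewrite -(leq_pmul2r (_ : 0 < 'C(n, #|A|))) ?bin_gt0 // cE.
  have BA : #|A| = #|B t| by rewrite cB.
  by have := card_perm_imset BA; rewrite card_ord -BA => ->.
have := level_center mN An; rewrite -/n -cE.
have c_gt0 : 0 < c by have := fact_gt0 n; rewrite -cE; case: (c).
rewrite -(leq_pmul2l c_gt0).
move: (\prod_j _) (_ * 'C(n, n./2)) (level _ _ _) ('C(_, _)) => p q w b.
by rewrite -!mulnA [b * p]mulnC [w * c]mulnC [q * (c * w)]mulnCA.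
Qed.

End Grid.

(** * The permutation hypermatrix of a realizer *)

Section Realizer.
Variables (disp : Order.disp_t) (P : finPOrderType disp) (d k : nat).
Hypothesis cardP : #|P| = k.
Variable L : 'I_d -> rel P.
Hypothesis linL : forall j, strict_linear_order (L j).
Hypothesis realL : forall x y : P, x != y -> ((x < y)%O <-> forall j, L j x y).
Hypothesis d_gt0 : 0 < d.

Lemma height_lt j p : #|[set q | L j q p]| < k.
Proof.
rewrite -cardP -cardsT; apply: proper_card; rewrite properT.
apply/eqP => E; have : p \in [set q | L j q p] by rewrite E inE.
by rewrite inE; case: (linL j) => ->.
Qed.

Definition height j p : 'I_k := Ordinal (height_lt j p).

Lemma height_mono j p q : L j p q = (height j p < height j q).
Proof.
have [irr tr tot] := linL j.
have mono x y : L j x y -> height j x < height j y.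
  move=> xy; apply: proper_card; apply/properP; split.
    by apply/subsetP => z; rewrite !inE => /tr; apply.
  by exists x; rewrite !inE ?irr.
apply/idP/idP => [|lt]; first exact: mono.
have [E|/tot/orP[//|/mono gt]] := eqVneq p q; first by rewrite E ltnn in lt.
by move: (ltn_trans lt gt); rewrite ltnn.
Qed.

Lemma height_inj j : injective (height j).
Proof.
move=> p q E; apply/eqP/contraT => /(let: And3 _ _ t := linL j in t _ _).
by rewrite !height_mono E ltnn.
Qed.

Definition point p : {ffun 'I_d -> 'I_k} := [ffun j => height j p].

Definition realizer_mx : hypermatrix d k := fun i => [exists p, i == point p].

Lemma realizer_mxP i : reflect (exists p, i = point p) (realizer_mx i).
Proof. by apply: (iffP existsP) => -[p /eqP]; exists p => //; apply/eqP. Qed.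

Lemma point_lt p q : (p < q)%O = [forall j, point p j < point q j].
Proof.
have [<-|pq] := eqVneq p q.
  rewrite Order.POrderTheory.ltxx; apply/esym/forallP => /(_ (Ordinal d_gt0)).
  by rewrite ltnn.
apply/idP/forallP => [/(realL pq) H j|H].
  by rewrite !ffunE -height_mono.
by apply/(realL pq) => j; rewrite height_mono; have := H j; rewrite !ffunE.
Qed.

Lemma point_inj : injective point.
Proof.
by move=> p q /ffunP/(_ (Ordinal d_gt0)); rewrite !ffunE => /height_inj.
Qed.

Lemma realizer_mx_permutation : permutation_hypermatrix realizer_mx.
Proof.
split.
  rewrite -[RHS]cardP /weight -(card_imset predT point_inj).
  apply: eq_card => i; rewrite inE; apply/realizer_mxP/imsetP => -[p].
    by move=> ->; exists p.
  by move=> _ ->; exists p.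
move=> j v.
have [g gK Kg] := inj_card_bij (@height_inj j) ltac:(by rewrite card_ord cardP).
rewrite (_ : [set i | _] = [set point (g v)]) ?cards1 //.
apply/setP => i; rewrite !inE; apply/andP/eqP => [[/realizer_mxP[p ->]]|->].
  by rewrite ffunE => /eqP <-; rewrite gK.
by split; [apply/realizer_mxP; exists (g v) | rewrite ffunE Kg].
Qed.

Lemma enum_val_lt n (S : {set 'I_n}) : {homo @enum_val _ (mem S) : a b / a < b}.
Proof.
move=> a b ab; have x0 := enum_val a; rewrite !(enum_val_nth x0).
have st : sorted (fun x y : 'I_n => x < y) (enum S).
  rewrite {1}/enum_mem -enumT; apply: sorted_filter.
    by move=> x y z; apply: ltn_trans.
  by have := iota_ltn_sorted 0 n; rewrite -val_enum_ord sorted_map.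
apply: (sorted_ltn_nth _ _ st) => //.
- by move=> x y z; apply: ltn_trans.
- by rewrite inE -cardE.
by rewrite inE -cardE.
Qed.

(** The indices selected in each coordinate are increasing, so the selected
    points of the box compare exactly as the points of [P]; distinct elements of
    [P] have distinct heights in every coordinate, so that weak and strict
    comparisons of points agree on them. *)
Lemma pullback_free N (m : 'I_d -> nat) (n := \sum_j m j)
    (B : {ffun 'I_d -> 'I_N} -> {set 'I_n}) (F : {set {set 'I_n}}) s :
  (forall t u, inbox m t -> inbox m u ->
     (B t \subset B u) = [forall j, t j <= u j]) ->
  ~~ contains_induced P F -> ~ contains (pullback B F s) realizer_mx.
Proof.
move=> subB /negP nF [S [cS H]]; apply: nF.
pose e j (a : 'I_k) : 'I_N := enum_val (cast_ord (esym (cS j)) a).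
have e_lt j a b : (e j a < e j b) = (a < b).
  have homo (x y : 'I_k) : x < y -> e j x < e j y.
    by move=> xy; apply: enum_val_lt.
  apply/idP/idP => [lt|]; last exact: homo.
  rewrite ltnNge leq_eqVlt; apply/negP => /orP[/eqP/val_inj E|/homo gt].
    by rewrite E ltnn in lt.
  by move: (ltn_trans lt gt); rewrite ltnn.
pose t p : {ffun 'I_d -> 'I_N} := [ffun j => e j (point p j)].
have tP p : inbox m (t p) && (s @: B (t p) \in F).
  by apply: (H (point p)); apply/realizer_mxP; exists p.
have tE p q j : (t p j < t q j) = (point p j < point q j) by rewrite !ffunE e_lt.
pose alpha := [ffun p => s @: B (t p)] : {ffun P -> {set 'I_n}}.
have sub p q : (alpha p \subset alpha q) = [forall j, point p j <= point q j].
  have [/andP[ip _] /andP[iq _]] := (tP p, tP q).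
  have imS (X Y : {set 'I_n}) : (s @: X \subset s @: Y) = (X \subset Y).
    apply/idP/idP; last exact: imsetS.
    move=> /subsetP sXY; apply/subsetP => x xX.
    have := sXY (s x); rewrite !mem_imset ?xX; try exact: perm_inj.
    by apply.
  rewrite !ffunE imS subB //; apply: eq_forallb => j.
  by rewrite leqNgt tE -leqNgt.
have pt_ne p q j : p != q -> point p j != point q j.
  by apply: contraNneq; rewrite !ffunE => /height_inj->.
apply/existsP; exists alpha; apply/and3P; split.
- apply/injectiveP => p q E; apply/point_inj/ffunP => j; apply/val_inj/eqP.
  have /forallP Hpq : [forall j, point p j <= point q j] by rewrite -sub E.
  have /forallP Hqp : [forall j, point q j <= point p j] by rewrite -sub E.
  by rewrite eqn_leq Hpq Hqp.
- by apply/forallP => p; rewrite ffunE; case/andP: (tP p).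
apply/forallP => p; apply/forallP => q; apply/eqP; rewrite properE !sub point_lt.
apply/forallP/andP => [lt|[/forallP le nle] j].
  split; first by apply/forallP => j; rewrite ltnW.
  by apply/forallPn; exists (Ordinal d_gt0); rewrite -ltnNge.
rewrite ltn_neqAle le andbT; apply: pt_ne; apply: contraNneq nle => ->.
by apply/forallP.
Qed.

Lemma free_family_bound (R : realFieldType) (K : R) N (m : 'I_d -> nat) :
  (forall M : hypermatrix d N,
     ~ contains M realizer_mx -> ((weight M)%:R <= K * N%:R ^+ (d - 1))%R) ->
  (forall j, m j < N) ->
  forall F : {set {set 'I_(\sum_j m j)}}, ~~ contains_induced P F ->
  ((\prod_j (m j).+1)%:R * #|F|%:R <=
   ((\sum_j m j).+1 * 'C(\sum_j m j, (\sum_j m j)./2))%:R *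
     (K * N%:R ^+ (d - 1)))%R.
Proof.
move=> HK mN F freeF; set n := \sum_j m j.
have [B [cB sB]] := box_embedding N m.
have avg := sum_weight_pullback mN F cB.
have W : ((\sum_s weight (pullback B F s))%:R <=
          n`!%:R * (K * N%:R ^+ (d - 1)))%R.
  rewrite natr_sum (le_trans (_ : _ <= \sum_(s : {perm 'I_n})
      (K * N%:R ^+ (d - 1)))%R) //.
    by apply: ler_sum => s _; apply/HK/(pullback_free sB freeF).
  by rewrite sumr_const card_Sn mulr_natl.
rewrite -(ler_pM2l (_ : 0 < n`!%:R)%R); last by rewrite ltr0n fact_gt0.
rewrite [leRHS]mulrCA (le_trans _ (ler_wpM2l (ler0n _ _) W)) //.
by rewrite -!natrM ler_nat.
Qed.

End Realizer.

(** * Blocks of nearly equal sizes *)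

Lemma succ_mul_exp3 e : e.+1 * 3 ^ e <= 2 * 4 ^ e.
Proof.
elim: e => [|[|[|e]] IH] //.
rewrite [3 ^ _]expnS [4 ^ _]expnS.
(* Passing from the exponent x to x + 1 multiplies the left side by
   3 (x + 2) / (x + 1), which is at most 4 only for x >= 2. *)
have h : e.+4 * 3 <= 4 * e.+3 by lia.
rewrite mulnA [X in _ <= X]mulnCA.
apply: leq_trans (leq_mul h (leqnn _)) _.
by rewrite -mulnA leq_mul2l.
Qed.

(** With [n = m * d + r], there are [r] blocks of size [m.+1] and [d - r] of size
    [m].  If [r = 0], both sides share the power of [m.+1] and [d <= 2 ^ d] is
    enough.  If [m = 0], the claim becomes [r.+1 <= 2 ^ r.+1].  Otherwise
    [m.+2 / m.+1] is at most [3 / 2], which reduces it to [succ_mul_exp3]. *)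
Lemma balanced_bound d m r : r < d ->
  (m + (0 < r)).+1 ^ (d - 1) * (m * d + r).+1 <=
  2 ^ d * (m.+2 ^ r * m.+1 ^ (d - r)).
Proof.
move=> rd.
have expS x : x ^ d = x * x ^ (d - 1) by rewrite -expnS; congr (_ ^ _); lia.
have [->|r0] := posnP r.
  rewrite mul1n subn0 !addn0 (expS m.+1).
  rewrite [X in _ <= X]mulnA [X in _ <= X]mulnC leq_mul2l; apply/orP; right.
  by have : d < 2 ^ d by [apply: ltn_expl]; nia.
rewrite addn1.
have [->|m0] := posnP m.
  rewrite mul0n add0n exp1n muln1 expS mulnAC mulnC leq_mul2r.
  by rewrite -expnS ltnW ?orbT // (leq_ltn_trans _ (ltn_expl r.+1 _)).
pose e := d - 1 - r.
have -> : d - 1 = r + e by rewrite /e; lia.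
have dE : d = r + e.+1 by rewrite /e; lia.
have -> : d - r = e.+1 by lia.
apply: (@leq_trans (m.+2 ^ (r + e) * (d * m.+1))).
  by rewrite leq_mul2l; apply/orP; right; nia.
rewrite expnD expnSr -!mulnA [X in _ <= X]mulnCA leq_mul2l; apply/orP; right.
rewrite !mulnA leq_mul2r; apply/orP; right.
rewrite -(leq_pmul2l (_ : 0 < 2 ^ e)) ?expn_gt0 //.
have h1 : 2 ^ e * m.+2 ^ e <= 3 ^ e * m.+1 ^ e.
  by rewrite -!expnMn; case: (e) => // e'; rewrite leq_exp2r //; lia.
have h2 : d * 3 ^ e <= 2 ^ e * 2 ^ d.
  have a : d <= e.+1 * 2 ^ r.
    have : r < 2 ^ r by rewrite ltn_expl.
    by rewrite dE; nia.
  apply: leq_trans (leq_mul a (leqnn _)) _.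
  rewrite mulnAC; apply: leq_trans (leq_mul (succ_mul_exp3 e) (leqnn _)) _.
  rewrite dE expnD expnS (expnMn 2 2).
  by move: (2 ^ e) (2 ^ r) => x y; lia.
rewrite mulnA mulnC mulnA.
apply: leq_trans (_ : d * (3 ^ e * m.+1 ^ e) <= _).
  by rewrite -mulnA leq_mul2l h1 orbT.
by rewrite mulnA [X in _ <= X]mulnA leq_mul2r h2 orbT.
Qed.

Lemma sum_balanced n d (m := n %/ d) (r := n %% d) : 0 < d ->
  \sum_(j < d) (m + (j < r)) = n.
Proof.
move=> d0; have rd : r <= d by rewrite ltnW // ltn_pmod.
rewrite big_split /= sum_nat_const card_ord -big_mkcond /=.
rewrite -(big_ord_widen _ (fun=> 1)) // sum_nat_const card_ord muln1 mulnC.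
by rewrite -divn_eq.
Qed.

Lemma prod_balanced n d (m := n %/ d) (r := n %% d) : 0 < d ->
  \prod_(j < d) (m + (j < r)).+1 = m.+2 ^ r * m.+1 ^ (d - r).
Proof.
move=> d0; have rd : r <= d by rewrite ltnW // ltn_pmod.
rewrite -(big_mkord xpredT (fun j => (m + (j < r)).+1)).
rewrite (@big_cat_nat _ _ _ r) //=.
congr (_ * _).
  rewrite big_nat (eq_bigr (fun=> m.+2)).
    by rewrite -big_nat prod_nat_const_nat subn0.
  by move=> j /andP[_ ->]; rewrite addn1.
rewrite big_nat (eq_bigr (fun=> m.+1)).
  by rewrite -big_nat prod_nat_const_nat.
by move=> j /andP[rj _]; rewrite ltnNge rj addn0.
Qed.

(** * The theorem *)

Theorem lemma2 (d k : nat) (disp : Order.disp_t) (P : finPOrderType disp)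
    (k_gt0 : 0 < k) (cardP : #|P| = k) (dimP : has_dimension P d) :
  exists2 MP : hypermatrix d k, permutation_hypermatrix MP &
    forall (R : realFieldType) (K : R),
      (forall n : nat, 0 < n -> forall M : hypermatrix d n,
         ~ contains M MP -> ((weight M)%:R <= K * n%:R ^+ (d - 1))%R) ->
      forall n : nat, 0 < n ->
        ((La_sharp n P)%:R <= 2 ^+ d * K * 'C(n, n./2)%:R)%R.
Proof.
have [d_gt0 [L linL realL] _] := dimP.
exists (realizer_mx cardP linL); first exact: realizer_mx_permutation.
move=> R K HK n n_gt0.
(* The zero matrix of side 1 avoids any nonzero matrix. *)
have K_ge0 : (0 <= K)%R.
  have := HK 1 isT (fun=> false).
  rewrite expr1n mulr1 /weight (_ : [set i | false] = set0) ?cards0; last first.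
    by apply/setP => i; rewrite !inE.
  apply=> -[S [cS H]]; have [p _] : exists p : P, true.
    by have := k_gt0; rewrite -cardP => /card_gt0P[p]; exists p.
  have /H // : realizer_mx cardP linL (point cardP linL p).
  by apply/realizer_mxP; exists p.
suff bound (F : {set {set 'I_n}}) : ~~ contains_induced P F ->
    (#|F|%:R <= 2 ^+ d * K * 'C(n, n./2)%:R)%R.
  apply: (big_ind (fun x => (x%:R <= 2 ^+ d * K * 'C(n, n./2)%:R)%R)) => //.
    by rewrite !mulr_ge0 // exprn_ge0.
  by move=> x y hx hy; rewrite /maxn; case: ifP.
pose m (j : 'I_d) := n %/ d + (j < n %% d).
pose N := (n %/ d + (0 < n %% d)).+1.
have mN j : m j < N.
  rewrite ltnS leq_add2l; case: (ltnP j) => // h.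
  by rewrite (leq_ltn_trans _ h).
have := free_family_bound realL d_gt0 (HK N isT) mN.
rewrite (sum_balanced n d_gt0) => /[apply] famF.
have num : N ^ (d - 1) * n.+1 <= 2 ^ d * \prod_j (m j).+1.
  by rewrite prod_balanced // {1}(divn_eq n d) balanced_bound ?ltn_pmod.
have pi_gt0 : (0 < (\prod_j (m j).+1)%:R :> R)%R by rewrite ltr0n prodn_gt0.
rewrite -(ler_pM2l pi_gt0) (le_trans famF) //.
move: num; rewrite -(ler_nat R) !natrM !natrX => num.
have KC_ge0 : (0 <= K * 'C(n, n./2)%:R)%R by rewrite mulr_ge0.
by have := ler_wpM2l KC_ge0 num; congr (_ <= _)%R; ring.
Qed.
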